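(* Let $H$ be the graph on vertex set $\{0,1,2,3\}$ with exactly one red edge $\{0,2\}$, exactly one blue edge $\{1,3\}$, and no other edges. Let $n\ge 4$ be an integer and define $k_0:=\lfloor x_0\rfloor$, where $$x_0:=\frac{3+\sqrt{2n^2-10n+13}}{2}.$$ Then $\Lambda_H(n)=\Lambda_H\big(QC(n,\binom{k_0+1}{2})\big)$. Moreover, if $2n^2-10n+13$ is not the square of an integer, then, up to isomorphism, $QC(n,\binom{k_0+1}{2})$ and its complement are the only graphs $G$ of order $n$ with $\Lambda_H(G)=\Lambda_H(n)$; if $2n^2-10n+13$ is the square of an integer, then there are at least $2(k_0+1)$ pairwise non-isomorphic graphs $G$ of order $n$ with $\Lambda_H(G)=\Lambda_H(n)$.
   Context: All graphs are finite and simple; the order of a graph is its number of vertices. For a graph $H$ whose edges are coloured red or blue and an uncoloured graph $G$, an embedding of $H$ into $G$ is an injection $V(H)\to V(G)$ that maps red edges of $H$ to edges of $G$ and blue edges of $H$ to non-edges of $G$ (pairs of distinct non-adjacent vertices). $\Lambda_H(G)$ is the number of embeddings of $H$ into $G$, and $\Lambda_H(n)$ is the maximum of $\Lambda_H(G)$ over all graphs $G$ of order $n$. For integers $n$ and $1\le e\le\binom n2$, the quasi-clique $QC(n,e)$ is the graph with $n$ vertices and $e$ edges obtained as follows: let $k$ be the maximum integer with $\binom k2<e$; take the complete graph $K_{k+1}$, remove $\binom{k+1}{2}-e$ edges forming a star (all incident to one common vertex), and add $n-k-1$ isolated vertices. *)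

(* Defs.v *)
From HB Require Import structures.
From mathcomp Require Import all_boot all_order all_algebra.
From mathcomp Require Import reals.
Set Implicit Arguments.
Unset Strict Implicit.
Unset Printing Implicit Defensive.
Import Order.TTheory GRing.Theory Num.Theory.

Definition simple_adj (V : finType) (a : {ffun V * V -> bool}) : bool :=
  [forall x, ~~ a (x, x)] && [forall x, forall y, a (x, y) == a (y, x)].

(* Adjacency is stored as a finite function so that [sgraph V] is a finType
   and one can take maxima over all graphs on V. *)
Record sgraph (V : finType) := SGraph {
  sgraph_val :> {ffun V * V -> bool};
  sgraphP : simple_adj sgraph_val }.

HB.instance Definition _ (V : finType) := [isSub for @sgraph_val V].
HB.instance Definition _ (V : finType) := [Finite of sgraph V by <:].

Definition adj (V : finType) (G : sgraph V) : rel V :=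
  fun x y => sgraph_val G (x, y).

Lemma adj_sym (V : finType) (G : sgraph V) : symmetric (adj G).
Proof.
by move=> x y; case/andP: (sgraphP G) => _ /forallP/(_ x)/forallP/(_ y)/eqP.
Qed.

Lemma adj_irr (V : finType) (G : sgraph V) : irreflexive (adj G).
Proof. by move=> x; case/andP: (sgraphP G) => /forallP/(_ x)/negbTE. Qed.

Definition rel_adj (V : finType) (r : rel V) : {ffun V * V -> bool} :=
  [ffun p => (p.1 != p.2) && (r p.1 p.2 || r p.2 p.1)].

Lemma rel_adjP (V : finType) (r : rel V) : simple_adj (rel_adj r).
Proof.
apply/andP; split; apply/forallP => x; first by rewrite ffunE eqxx.
by apply/forallP => y; apply/eqP; rewrite !ffunE /= eq_sym orbC.
Qed.

(* Distinct x and y are joined iff r x y or r y x. *)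
Definition graph_of_rel (V : finType) (r : rel V) : sgraph V :=
  SGraph (rel_adjP r).

Lemma adj_graph_of_rel (V : finType) (r : rel V) (x y : V) :
  adj (graph_of_rel r) x y = (x != y) && (r x y || r y x).
Proof. by rewrite /adj /= ffunE. Qed.

Definition graph_compl (V : finType) (G : sgraph V) : sgraph V :=
  graph_of_rel (fun x y => ~~ adj G x y).

Lemma adj_compl (V : finType) (G : sgraph V) (x y : V) :
  adj (graph_compl G) x y = (x != y) && ~~ adj G x y.
Proof. by rewrite adj_graph_of_rel (adj_sym G y x) orbb. Qed.

Definition graph_iso (V W : finType) (G : sgraph V) (G' : sgraph W) : Prop :=
  exists2 f : V -> W, bijective f & forall x y, adj G' (f x) (f y) = adj G x y.

Record cgraph (V : finType) := CGraph {
  red : sgraph V;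
  blue : sgraph V;
  red_blue_disjoint : forall x y, ~~ (adj red x y && adj blue x y) }.

Definition is_embedding (V W : finType) (H : cgraph V) (G : sgraph W)
    (f : {ffun V -> W}) : bool :=
  [&& injectiveb f,
      [forall x, forall y, adj (red H) x y ==> adj G (f x) (f y)]
    & [forall x, forall y, adj (blue H) x y ==>
                           adj (graph_compl G) (f x) (f y)]].

Definition Lambda (V W : finType) (H : cgraph V) (G : sgraph W) : nat :=
  #|[set f : {ffun V -> W} | is_embedding H G f]|.

Definition Lambda_max (V : finType) (H : cgraph V) (n : nat) : nat :=
  \max_(G : sgraph 'I_n) Lambda H G.

(* The largest k with 'C(k, 2) < e, for e >= 1; the bound k <= e on the search
   range excludes nothing, see [qc_kP]. *)
Definition qc_k (e : nat) : nat := \max_(k < e.+1 | 'C(k, 2) < e) k.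

Lemma qc_kP (e : nat) : 0 < e ->
  'C(qc_k e, 2) < e /\ forall k, 'C(k, 2) < e -> k <= qc_k e.
Proof.
move=> e_gt0; split.
  rewrite /qc_k; elim/big_ind: _ => [|x y hx hy|i //]; first by rewrite bin0n.
  by rewrite /maxn; case: ifP.
move=> k hk; have k_le : k < e.+1.
  case: k hk => // k; rewrite binS bin1 ltnS => hk.
  by apply: leq_ltn_trans hk; apply: leq_addl.
exact: (@leq_bigmax_cond _ (fun i : 'I_e.+1 => 'C(i, 2) < e)
          (fun i : 'I_e.+1 => i : nat) (Ordinal k_le) hk).
Qed.

(* The complete graph lives on {0, ..., k}; the deleted star is centred at k
   and has the leaves j < 'C(k + 1, 2) - e (fewer than k of them).  The
   construction is meant for 1 <= e <= 'C(n, 2), in which case k < n. *)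
Definition QC (n e : nat) : sgraph 'I_n :=
  let k := qc_k e in
  graph_of_rel (fun i j : 'I_n =>
    [&& j < i, i <= k & ~~ ((i == k :> nat) && (j < 'C(k.+1, 2) - e))]).

Definition H_red : sgraph 'I_4 :=
  graph_of_rel (fun i j : 'I_4 => (i == 0 :> nat) && (j == 2 :> nat)).

Definition H_blue : sgraph 'I_4 :=
  graph_of_rel (fun i j : 'I_4 => (i == 1 :> nat) && (j == 3 :> nat)).

Lemma H_disjoint (x y : 'I_4) : ~~ (adj H_red x y && adj H_blue x y).
Proof.
by rewrite !adj_graph_of_rel; case: x y => [[|[|[|[|?]]]] ?] [[|[|[|[|?]]]] ?].
Qed.

Definition H : cgraph 'I_4 := CGraph H_disjoint.

Definition x0 (R : realType) (n : nat) : R :=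
  ((3 + Num.sqrt (2 * n%:R ^+ 2 - 10 * n%:R + 13)) / 2)%R.

(* [x0 R n] is positive, so the absolute value only converts int to nat. *)
Definition k0 (R : realType) (n : nat) : nat := `|Num.floor (x0 R n)|%N.

Definition disc_square (n : nat) : Prop :=
  exists m : int, (2 * n%:Z ^+ 2 - 10 * n%:Z + 13 = m ^+ 2)%R.

(* Main.v *)
(** Counting disjoint (edge, non-edge) pairs by inclusion-exclusion gives, with
    d the degrees and E their sum, Lambda H G = E (t - E) + 4 sum d^2 for
    t = (n - 1) (n - 4).  Replacing an edge ux by vx with d(v) >= d(u) increases
    sum d^2 strictly, so a maximiser is a threshold graph.  For all t at once, one
    shows by induction on the order that a threshold graph which is neither a
    clique plus isolated vertices (value C(k)) nor the complement of one is
    beaten by such a graph, or else its value is attained by two such graphs of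
    the same kind with consecutive k.  Up to complementation the graph has an
    isolated vertex, because complementation only changes t and adds a constant;
    removing it changes nothing, and the only new case is an isolated vertex added
    to the join of K_a with b independent vertices.  There the value is compared
    with explicit convex combinations: of two consecutive complements of cliques if
    a <= b, and of two consecutive cliques if a > b.
    Finally, for t = (n - 1) (n - 4), C(k+1) - C(k) = k (D - (2k - 3)^2) with
    D = 2n^2 - 10n + 13, so C is maximal at k0 + 1.  When D = (2 k0 - 3)^2, joining
    one new vertex to j vertices of K_k0 does not change the value. *)
Require Import Defs.
From mathcomp Require Import all_boot all_order all_algebra.
From mathcomp Require Import reals zify ring lra.
Set Implicit Arguments.
Unset Strict Implicit.
Unset Printing Implicit Defensive.
Import Order.TTheory GRing.Theory Num.Theory.
Local Open Scope ring_scope.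

(** * Values of cliques and of their complements *)

Definition clique_val (t k : int) : int :=
  k * (k - 1) * (t - k * (k - 1)) + 4 * k * (k - 1) ^+ 2.

(* [score_compl]: complementing a graph on m vertices turns the parameter t into
   [dual_param m t] and adds [dual_shift m (dual_param m t)] to the value. *)
Definition dual_param (m t : int) : int := 2 * (m - 1) * (m - 4) - t.

Definition dual_shift (m t : int) : int := m * (m - 1) * (t - (m - 1) * (m - 4)).

(* The value of the complement, among m vertices, of a clique on b vertices. *)
Definition coclique_val (m t b : int) : int :=
  clique_val (dual_param m t) b - dual_shift m (dual_param m t).

Lemma dualK m : involutive (dual_param m).
Proof. by move=> t; rewrite /dual_param; ring. Qed.

Lemma shift_dual m t : dual_shift m (dual_param m t) = - dual_shift m t.
Proof. by rewrite /dual_shift /dual_param; ring. Qed.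

Lemma convex_dichotomy (p q u v w : int) : 0 < p -> 0 < q ->
  (p + q) * w <= p * u + q * v -> w < u \/ w < v \/ u = w /\ v = w.
Proof. move=> p0 q0 h; nia. Qed.

(** The join of K_a with b independent vertices, plus an isolated vertex, is compared with the joins
    of K_a with b + 1 and of K_(a-1) with b + 2. As [t] multiplies the edge number, weights valid
    for all [t] must average the edge numbers; they are positive for 0 < a <= b. *)
Lemma coclique_val_interp (a b t : int) : (b + 1) * coclique_val (a + b) t b =
  (b + 1 - a) * coclique_val (a + b + 1) t (b + 1)
    + a * coclique_val (a + b + 1) t (b + 2).
Proof. rewrite /coclique_val /clique_val /dual_shift /dual_param; ring. Qed.

(** The gain, free of [t], on passing from the complement of K_b among s vertices to the weighted
    mean of K_(s-c) and K_(s-c-1) with the same mean number of edges. *)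
Definition slack (s b c : int) : int :=
  let X := b * (b - 1) - c * (2 * s - c - 1) in
  2 * (s - 2 * b + 1) * c * (2 * s - c - 1) + 2 * c * (c - 1) * (s - 1)
   + 4 * (s - c) * c ^+ 2 - X * (4 * b - 6 - 8 * c - X).

(* X is twice the difference between the number of edges of a clique on b vertices
   and that of the join of K_c with s - c independent vertices. *)
Lemma coclique_val_clique_interp (s b c t : int) :
  let X := b * (b - 1) - c * (2 * s - c - 1) in
  (2 * (s - 1 - c) - X) * clique_val t (s - c) + X * clique_val t (s - c - 1) =
  2 * (s - 1 - c) * (coclique_val s t b + slack s b c).
Proof. rewrite /= /slack /coclique_val /clique_val /dual_shift /dual_param; ring. Qed.

(** The last two hypotheses place the edge number of the complement of K_b above that of K_(s-c-1)
    and at most at that of K_(s-c). *)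
Lemma slack_ge0 (s b c : int) : 2 <= b -> 2 * b <= s -> 0 <= c -> c < b ->
  c * (2 * s - c - 1) <= b * (b - 1) ->
  b * (b - 1) < (c + 1) * (2 * s - c - 2) -> 0 <= slack s b c.
Proof.
move=> b2 bs c0 cb lo hi.
have [->|c1] : c = 0 \/ 1 <= c by lia.
  have -> : slack s b 0 = b * (b - 1) * ((b - 2) * (b - 3)) by rewrite /slack; ring.
  have [->|[->|b4]] : b = 2 \/ b = 3 \/ 4 <= b by lia.
  - by [].
  - by [].
  - by apply: mulr_ge0; apply: mulr_ge0; lia.
(* As s >= 2b and c < b, the factor 2s - c - 1 exceeds 3 (b - 1), so [lo] forces this. *)
have c3b : 3 * c <= b.
  have h : c * (3 * (b - 1)) <= c * (2 * s - c - 1) by apply: ler_wpM2l; lia.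
  nia.
have ccc : 0 <= c * (c - 1) * (s - 1) by apply: mulr_ge0; [apply: mulr_ge0|]; lia.
have b5 : c = 1 -> 5 <= b.
  move=> E; rewrite leNgt; apply/negP => b5; move: lo; rewrite E mul1r.
  have [b_eq|[b_eq|b_eq]] : b = 2 \/ b = 3 \/ b = 4 by lia.
  - by rewrite b_eq; lia.
  - by rewrite b_eq; lia.
  - by rewrite b_eq; lia.
pose f : int := b - 3 * c; pose d : int := s - 2 * b.
have f0 : 0 <= f by rewrite /f; lia.
have d0 : 0 <= d by rewrite /d; lia.
(* Completing the square, X (4b - 6 - 8c - X) = Q^2 - (X - Q)^2. The only negative summand left is -
   Q^2, which [hi] bounds; the rest is expanded in the nonnegative c, d and f. *)
pose Q : int := 2 * b - 3 - 4 * c.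
have sq : slack s b c = 2 * (s - 2 * b + 1) * c * (2 * s - c - 1)
   + 2 * c * (c - 1) * (s - 1) + 4 * (s - c) * c ^+ 2 - Q ^+ 2
   + (b * (b - 1) - c * (2 * s - c - 1) - Q) ^+ 2.
  by rewrite /slack /Q; ring.
have Q2 : Q ^+ 2 = 4 * (b * (b - 1)) - 8 * b + 9 + 16 * c ^+ 2 - 16 * (b * c) + 24 * c.
  by rewrite /Q; ring.
have sqr_ge : 0 <= (b * (b - 1) - c * (2 * s - c - 1) - Q) ^+ 2 by apply: sqr_ge0.
have R : Q ^+ 2 <= 12 * c ^+ 2 + 8 * c * d + 36 * c + 8 * f + 8 * d - 3.
  have -> : 12 * c ^+ 2 + 8 * c * d + 36 * c + 8 * f + 8 * d - 3
    = 4 * ((c + 1) * (2 * s - c - 2)) - 4 - 8 * b + 9 + 16 * c ^+ 2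
      - 16 * (b * c) + 24 * c by rewrite /d /f; ring.
  by rewrite Q2; lia.
have cf : 0 <= c * f by apply: mulr_ge0; lia.
have ccf : c * f <= c * (c * f) by rewrite ler_peMl //; lia.
have cd : 0 <= c * d by apply: mulr_ge0; lia.
have ccd : c * d <= c * (c * d) by rewrite ler_peMl //; lia.
have cdf : 0 <= d * (c * f) by apply: mulr_ge0; lia.
have cdd : 0 <= d * (c * d) by apply: mulr_ge0; lia.
have c2 : c <= c * c by rewrite ler_peMl //; lia.
have c3 : c * c <= c * (c * c) by rewrite ler_peMl //; lia.
have L : 2 * (s - 2 * b + 1) * c * (2 * s - c - 1) + 4 * (s - c) * c ^+ 2
  = 22 * (c * c) + 8 * (c * f) + 4 * (c * d) - 2 * c + 22 * (c * (c * d))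
    + 8 * (d * (c * f)) + 4 * (d * (c * d)) - 2 * (c * d)
    + 20 * (c * (c * c)) + 8 * (c * (c * f)) + 4 * (c * (c * d)).
  by rewrite /d /f; ring.
have fd : f <= c * f by rewrite ler_peMl //; lia.
have dd : d <= c * d by rewrite ler_peMl //; lia.
(* For c = 1 the powers of c alone are too small; there [b5] gives f >= 2. *)
have fc : 38 * c <= 10 * (c * c) + 20 * (c * (c * c)) + 8 * f.
  have [E|c2'] : c = 1 \/ 2 <= c by lia.
    by move: (b5 E); rewrite /f E; lia.
  have h : 2 * c <= c * c by apply: ler_wpM2r; lia.
  have h' : 2 * (c * c) <= c * (c * c) by apply: ler_wpM2r; lia.
  lia.
rewrite expr2 in R.
lia.
Qed.

Lemma search_last (P : pred int) (b : nat) : P 0 -> ~~ P b%:Z ->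
  exists2 c : nat, (c < b)%N & P c%:Z && ~~ P (c%:Z + 1).
Proof.
move=> P0; elim: b => [|b IH Pb]; first by rewrite P0.
have [Pb'|/IH[c cb Pc]] := boolP (P b%:Z).
  by exists b => //; rewrite Pb' addrC -intS.
by exists c; first exact: ltnW.
Qed.

(** The two cliques are the consecutive ones whose edge numbers enclose that of the complement of
    K_b. *)
Lemma coclique_below_cliques (s b : nat) (t : int) : (2 <= b)%N -> (2 * b <= s)%N ->
  exists2 k : nat, (0 < k < s)%N &
    [\/ coclique_val s t b < clique_val t k, coclique_val s t b < clique_val t k.+1
       | clique_val t k = coclique_val s t b /\ clique_val t k.+1 = coclique_val s t b].
Proof.
move=> b2 bs.
(* [P c] says that K_(s-c) has at least as many edges as the complement of K_b; the last such c is
   taken. *)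
pose P (c : int) := c * (2 * s%:Z - c - 1) <= b%:Z * (b%:Z - 1).
have Pb : ~~ P b by rewrite /P -ltNge; nia.
have [//|c cb /andP[Pc Pc']] := @search_last P b _ Pb; first by rewrite /P mul0r; nia.
rewrite /P -ltNge in Pc'; rewrite /P in Pc.
have hi : b%:Z * (b%:Z - 1) < (c%:Z + 1) * (2 * s%:Z - c%:Z - 2) by nia.
have sl : 0 <= slack s b c by apply: slack_ge0 => //; lia.
have := coclique_val_clique_interp s b c t; rewrite /=.
set X := b%:Z * _ - _ => E.
have X0 : 0 <= X by rewrite /X; lia.
have Xr : X < 2 * (s%:Z - 1 - c%:Z) by rewrite /X; nia.
exists (s - c - 1)%N; first by lia.
have -> : (s - c - 1)%:Z = s%:Z - c%:Z - 1 by lia.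
have -> : (s - c - 1).+1%:Z = s%:Z - c%:Z by lia.
have [XE|X1] : X = 0 \/ 0 < X by lia.
  apply: Or32.
  have c0 : 0 < c%:Z by move: XE; rewrite /X; nia.
  have sl' : 0 < slack s b c.
    rewrite /slack -/X XE mul0r subr0.
    have h1 : 0 < 4 * (s%:Z - c%:Z) * c%:Z ^+ 2.
      by apply: mulr_gt0; [lia|exact: exprn_gt0].
    have h2 : 0 <= 2 * c%:Z * (c%:Z - 1) * (s%:Z - 1).
      by apply: mulr_ge0; [apply: mulr_ge0|]; lia.
    have h3 : 0 <= 2 * (s%:Z - 2 * b%:Z + 1) * c%:Z * (2 * s%:Z - c%:Z - 1).
      by apply: mulr_ge0; [apply: mulr_ge0|]; lia.
    lia.
  move: E; rewrite XE subr0 mul0r addr0 => /mulfI E.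
  by rewrite E; [rewrite ltrDl|apply/eqP; lia].
have [||||[]] := @convex_dichotomy (2 * (s%:Z - 1 - c%:Z) - X) X
  (clique_val t (s%:Z - c%:Z)) (clique_val t (s%:Z - c%:Z - 1))
  (coclique_val s t b).
- by rewrite subr_gt0.
- by [].
- rewrite E subrK; apply: ler_wpM2l; first by lia.
  by rewrite lerDl.
- by move=> ?; apply: Or32.
- by move=> ?; apply: Or31.
- by case=> ? ?; apply: Or33.
Qed.

(** The tie clause demands two consecutive orders: at [tau n] this contradicts the uniqueness of the
    best order when the discriminant is not a square. *)
Definition beaten_or_tied (m : nat) (t v : int) : Prop :=
  (exists2 k : nat, (k <= m)%N & v < clique_val t k \/ v < coclique_val m t k) \/
  (exists2 k : nat, (0 < k < m)%N &
     (clique_val t k = v /\ clique_val t k.+1 = v) \/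
     (coclique_val m t k = v /\ coclique_val m t k.+1 = v)).

Lemma beaten_or_tied_dual m t v :
  beaten_or_tied m (dual_param m t) (v + dual_shift m (dual_param m t)) ->
  beaten_or_tied m t v.
Proof.
have coE k : coclique_val m (dual_param m t) k =
    clique_val t k + dual_shift m (dual_param m t).
  by rewrite /coclique_val dualK shift_dual.
have clE k : clique_val (dual_param m t) k =
    coclique_val m t k + dual_shift m (dual_param m t).
  by rewrite /coclique_val subrK.
case=> -[k km hk]; [left|right]; exists k => //.
  by move: hk; rewrite coE clE !ltrD2r; case; [right|left].
by move: hk; rewrite !coE !clE; case=> -[/addIr ? /addIr ?]; [right|left].
Qed.

Lemma coclique_val1 (m t : int) : coclique_val m t 1 = clique_val t m.
Proof. by rewrite /coclique_val /clique_val /dual_shift /dual_param; ring. Qed.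

Lemma coclique_val0 (m t : int) : coclique_val m t 0 = clique_val t m.
Proof. by rewrite /coclique_val /clique_val /dual_shift /dual_param; ring. Qed.

Lemma coclique_val_full (m t : int) : coclique_val m t m = 0.
Proof. by rewrite /coclique_val /clique_val /dual_shift /dual_param; ring. Qed.

Lemma clique_val0 (t : int) : clique_val t 0 = 0. Proof. by rewrite /clique_val; ring. Qed.

Lemma clique_val1 (t : int) : clique_val t 1 = 0. Proof. by rewrite /clique_val; ring. Qed.

Lemma coclique_isolated m b t : (1 < b < m)%N -> beaten_or_tied m.+1 t (coclique_val m t b).
Proof.
(* The dominating clique has m - b vertices, so this asks whether it has at most b. *)
move=> /andP[b1 bm]; have [mb|bm2] := leqP m (2 * b).
  have := coclique_val_interp (m%:Z - b%:Z) b t; rewrite subrK.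
  have -> : b%:Z + 1 - (m%:Z - b%:Z) = (2 * b + 1 - m)%N :> int by lia.
  have -> : m%:Z + 1 = m.+1 :> int by lia.
  have -> : b%:Z + 1 = b.+1 :> int by lia.
  have -> : b%:Z + 2 = b.+2 :> int by lia.
  move=> E.
  have [||||[|[e1 e2]]] := @convex_dichotomy (2 * b + 1 - m)%N (m%:Z - b%:Z)
    (coclique_val m.+1 t b.+1) (coclique_val m.+1 t b.+2)
    (coclique_val m t b); try by lia.
  - by move=> h; left; exists b.+1; [lia|right].
  - by move=> h; left; exists b.+2; [lia|right].
  - by right; exists b.+1; [lia|right].
have [//||k km [h|h|h]] := @coclique_below_cliques m b t; first by lia.
- by left; exists k; [lia|left].
- by left; exists k.+1; [lia|left].
- by right; exists k; [lia|left].
Qed.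

(** Cliques survive an isolated vertex unchanged. A complement of K_k does not keep its kind and is
    replaced through [coclique_isolated], except for k = 0, 1 or m, where it is complete or
    edgeless. *)
Lemma beaten_or_tied_isolated m t v :
  beaten_or_tied m t v -> beaten_or_tied m.+1 t v.
Proof.
case=> -[k km [h|h]].
- by left; exists k; [lia|left].
- have [k1|k1] := leqP k 1.
    left; exists m; first by lia.
    left; rewrite -coclique_val1.
    suff -> : coclique_val m t 1 = coclique_val m t k by [].
    by case: k k1 {km h} => [|[|//]] _; rewrite // coclique_val0 coclique_val1.
  have [km'|km'] := eqVneq k m.
    by left; exists 0%N => //; left; rewrite clique_val0 -(coclique_val_full m t) -{2}km'.
  have [|[j jm hj]|[j jm hj]] := @coclique_isolated m k t; first by lia.
    by left; exists j => //; case: hj => hj; [left|right]; apply: lt_trans hj.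
  by left; exists j; [lia|]; case: hj => -[-> _]; [left|right].
- by right; exists k; [lia|left].
- have [k1|k1] := ltnP 1 k.
    by case: h => <- _; apply: coclique_isolated; rewrite k1; lia.
  have k_eq : k = 1%N by lia.
  rewrite k_eq in h; case: h => h1 h2.
  (* For k = 1 the tie is between K_m and the complement of K_2. If m = 2 the latter is edgeless, so
     K_1 and K_2 tie; otherwise [coclique_isolated] applies with b = 2. *)
  have [m3|m3] := leqP m 2.
    have m2 : m = 2%N by lia.
    right; exists 1%N; first by lia.
    by left; rewrite -h1 coclique_val1 m2 clique_val1; move: h2; rewrite m2 coclique_val_full -h1 m2 coclique_val1.
  by rewrite -h2; apply: coclique_isolated; lia.
Qed.

(** * Threshold graphs *)

Definition deg (V : finType) (r : rel V) (A : {set V}) (x : V) : int :=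
  \sum_(y in A) (r x y)%:R.

Definition edge2 (V : finType) (r : rel V) (A : {set V}) : int :=
  \sum_(x in A) deg r A x.

Definition deg2 (V : finType) (r : rel V) (A : {set V}) : int :=
  \sum_(x in A) deg r A x ^+ 2.

(** With [t = tau #|V|] on all of [V] this is [Lambda], by [LambdaE]; [t] stays free because
    complementing inside a subset changes it. *)
Definition score (V : finType) (t : int) (r : rel V) (A : {set V}) : int :=
  edge2 r A * (t - edge2 r A) + 4 * deg2 r A.

Definition rel_compl (V : finType) (r : rel V) : rel V :=
  fun x y => (x != y) && ~~ r x y.

Definition clique_on (V : finType) (r : rel V) (A B : {set V}) : Prop :=
  B \subset A /\
  {in A &, forall x y, r x y = [&& x != y, x \in B & y \in B]}.

(** The weight is a datum rather than the degree: the same [w] serves after deleting vertices, and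
    its opposite after complementing. *)
Definition threshold (V : finType) (r : rel V) (w : V -> int) : Prop :=
  forall u v x, w u <= w v -> x != v -> r u x -> r v x.

Section Threshold.
Variables (V : finType).
Implicit Types (r : rel V) (A B : {set V}) (t : int).

Lemma eq_score r r' A t : {in A &, r =2 r'} -> score t r A = score t r' A.
Proof.
move=> rr; have dd x : x \in A -> deg r A x = deg r' A x.
  by move=> xA; apply: eq_bigr => y yA; rewrite rr.
have ee : edge2 r A = edge2 r' A by apply: eq_bigr.
have pp : deg2 r A = deg2 r' A by apply: eq_bigr => x xA; rewrite dd.
by rewrite /score ee pp.
Qed.

Lemma sum_mem A B : B \subset A -> \sum_(y in A) (y \in B)%:R = #|B|%:Z.
Proof.
move=> /setIidPr <-; rewrite -natr_sum -natz -sum1_card; congr (_%:R).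
rewrite [RHS]big_mkcond [LHS]big_mkcond; apply: eq_bigr => y _ /=.
by rewrite inE; case: (y \in A); case: (y \in B).
Qed.

Lemma sum_pred1 A x (F : V -> int) : x \in A ->
  \sum_(y in A) (y == x)%:R * F y = F x.
Proof.
move=> xA; rewrite (bigD1 x) //= eqxx mul1r big1 ?addr0 // => y /andP[_ /negbTE ->].
by rewrite mul0r.
Qed.

Lemma sum_const A (c : int) : \sum_(x in A) c = #|A|%:Z * c.
Proof. by rewrite sumr_const -mulr_natl natz. Qed.

Lemma deg_clique r A B : clique_on r A B ->
  {in A, forall x, deg r A x = (x \in B)%:R * (#|B|%:Z - 1)}.
Proof.
move=> [sBA rE] x xA; rewrite /deg.
have -> : \sum_(y in A) (r x y)%:R =
   \sum_(y in A) (x \in B)%:R * ((y \in B)%:R - (y == x)%:R * 1) :> int.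
  apply: eq_bigr => y yA; rewrite rE // eq_sym.
  have [->|_] := eqVneq y x; first by case: (x \in B).
  by case: (x \in B); case: (y \in B).
rewrite -mulr_sumr big_split sumrN /= sum_mem //.
by rewrite (@sum_pred1 _ _ (fun=> 1)).
Qed.

Lemma score_clique r A B t : clique_on r A B -> score t r A = clique_val t #|B|.
Proof.
move=> c; have dE := deg_clique c.
have -> : score t r A = let E := #|B|%:Z * (#|B|%:Z - 1) in
    E * (t - E) + 4 * (#|B|%:Z * (#|B|%:Z - 1) ^+ 2).
  rewrite /score /=.
  have -> : edge2 r A = #|B|%:Z * (#|B|%:Z - 1).
    by rewrite /edge2 (eq_bigr _ dE) -mulr_suml sum_mem //; case: c.
  suff -> : deg2 r A = #|B|%:Z * (#|B|%:Z - 1) ^+ 2 by [].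
  transitivity ((\sum_(x in A) (x \in B)%:R) * (#|B|%:Z - 1) ^+ 2); last first.
    by rewrite sum_mem //; case: c.
  rewrite mulr_suml; apply: eq_bigr => x xA; rewrite dE //.
  by case: (x \in B); rewrite ?mul1r ?mul0r.
by rewrite /clique_val /=; ring.
Qed.

Lemma deg_compl r A : irreflexive r ->
  {in A, forall x, deg (rel_compl r) A x = #|A|%:Z - 1 - deg r A x}.
Proof.
move=> ir x xA; rewrite /deg.
have -> : \sum_(y in A) (rel_compl r x y)%:R =
   \sum_(y in A) (1 - (y == x)%:R * 1 - (r x y)%:R) :> int.
  apply: eq_bigr => y yA; rewrite /rel_compl eq_sym.
  by have [->|_] := eqVneq y x; [rewrite ir|case: (r x y)].
rewrite !big_split /= !sumrN sum_const.
by rewrite (@sum_pred1 _ _ (fun=> 1)) // mulr1.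
Qed.

Lemma score_compl r A t : irreflexive r ->
  score (dual_param #|A| t) (rel_compl r) A =
  score t r A + dual_shift #|A| (dual_param #|A| t).
Proof.
move=> ir; have dE := deg_compl ir.
have E : edge2 (rel_compl r) A = #|A|%:Z * (#|A|%:Z - 1) - edge2 r A.
  by rewrite /edge2 (eq_bigr _ (dE A)) big_split /= sumrN sum_const.
have P : deg2 (rel_compl r) A = #|A|%:Z * (#|A|%:Z - 1) ^+ 2
    - 2 * (#|A|%:Z - 1) * edge2 r A + deg2 r A.
  rewrite /edge2 mulr_sumr -sum_const -sumrN -!big_split /=.
  by apply: eq_bigr => x xA; rewrite dE //; ring.
by rewrite /score E P /dual_shift /dual_param; ring.
Qed.

Lemma complK r : irreflexive r -> rel_compl (rel_compl r) =2 r.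
Proof.
move=> ir x y; rewrite /rel_compl negb_and !negbK.
by have [->|] := eqVneq x y; rewrite ?ir.
Qed.

Lemma compl_irr r : irreflexive (rel_compl r).
Proof. by move=> x; rewrite /rel_compl eqxx. Qed.

Lemma compl_sym r : symmetric r -> symmetric (rel_compl r).
Proof. by move=> sr x y; rewrite /rel_compl eq_sym sr. Qed.

Lemma threshold_compl r w : symmetric r -> irreflexive r ->
  threshold r w -> threshold (rel_compl r) (fun x => - w x).
Proof.
move=> sr ir th u v x; rewrite lerN2 => wvu xv /andP[ux rux].
rewrite /rel_compl eq_sym xv /=; apply: contra rux => rvx.
by apply: th wvu _ rvx; rewrite eq_sym.
Qed.

Lemma score_isolated r A v t : symmetric r -> v \in A ->
  {in A, forall x, r v x = false} -> score t r A = score t r (A :\ v).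
Proof.
move=> sr vA iv.
have dv : deg r A v = 0 by rewrite /deg big1 // => x xA; rewrite iv.
have dE x : x \in A -> deg r A x = deg r (A :\ v) x.
  by move=> xA; rewrite /deg (big_setD1 v) //= sr iv // add0r.
have e : edge2 r A = edge2 r (A :\ v).
  rewrite /edge2 (big_setD1 v) //= dv add0r.
  by apply: eq_bigr => x /setD1P[_ /dE].
have p : deg2 r A = deg2 r (A :\ v).
  rewrite /deg2 (big_setD1 v) //= dv expr0n add0r.
  by apply: eq_bigr => x /setD1P[_ /dE ->].
by rewrite /score e p.
Qed.

Definition extremal r A t : Prop :=
  [\/ exists B, clique_on r A B, exists B, clique_on (rel_compl r) A B
    | beaten_or_tied #|A| t (score t r A)].

Lemma extremal_compl r A t : irreflexive r ->
  extremal (rel_compl r) A (dual_param #|A| t) -> extremal r A t.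
Proof.
move=> ir [[B c]|[B [sBA c]]|h]; first by apply: Or32; exists B.
  by apply: Or31; exists B; split=> // x y xA yA; rewrite -c // complK.
by apply: Or33; apply: beaten_or_tied_dual; rewrite -score_compl.
Qed.

Lemma extremal_isolated r A v t : symmetric r -> irreflexive r -> v \in A ->
  {in A, forall x, r v x = false} -> extremal r (A :\ v) t -> extremal r A t.
Proof.
move=> sr ir vA iv.
have cA : #|A| = #|A :\ v|.+1 by rewrite (cardsD1 v) vA.
have lift B : clique_on r (A :\ v) B -> clique_on r A B.
  move=> [sB c]; split; first exact: subset_trans sB (subsetDl _ _).
  have vB : v \notin B by apply/negP => /(subsetP sB); rewrite !inE eqxx.
  move=> x y xA yA; have [->|xv] := eqVneq x v.
    by rewrite iv // (negbTE vB) andbF.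
  have [->|yv] := eqVneq y v; first by rewrite sr iv // (negbTE vB) !andbF.
  by rewrite c // !inE ?xv ?yv.
case=> [[B c]|[B c]|h].
- by apply: Or31; exists B; apply: lift.
- have rE x y : x \in A :\ v -> y \in A :\ v ->
     r x y = (x != y) && ~~ ((x \in B) && (y \in B)).
    move=> xA yA; rewrite -complK // /rel_compl; case: c => _ /(_ x y xA yA) /=.
    by rewrite /rel_compl => ->; case: eqP.
  (* If [B] has at most one vertex, the graph is complete on [A :\ v]; if [B] is all of [A :\ v], it
     is edgeless. Both remain cliques with isolated vertices once [v] is added. *)
  have [b1|b1] := leqP #|B| 1.
    apply: Or31; exists (A :\ v); apply: lift; split=> // x y xA yA.
    rewrite rE // xA yA !andbT; apply: andb_idr => xy.
    apply/negP => /andP[xB yB]; move: xy.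
    by move/card_le1_eqP: b1 => /(_ x y xB yB) ->; rewrite eqxx.
  have [bm|bm] := eqVneq #|B| #|A :\ v|.
    have /eqP BE : B == A :\ v by rewrite eqEcard bm leqnn andbT; case: c.
    apply: Or31; exists set0; apply: lift; split; first exact: sub0set.
    by move=> x y xA yA; rewrite rE // BE xA yA /= !inE andbF.
  apply: Or33; rewrite cA (score_isolated _ sr vA iv).
  have -> : score t r (A :\ v) = coclique_val #|A :\ v| t #|B|.
    by rewrite /coclique_val -(score_clique _ c) score_compl // addrK.
  apply: coclique_isolated; rewrite b1 ltn_neqAle bm /=.
  by apply: subset_leq_card; case: c.
by apply: Or33; rewrite cA (score_isolated _ sr vA iv); apply: beaten_or_tied_isolated.
Qed.

(** Let v have the largest weight in A. A vertex of A other than v and not adjacent to v has no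
    neighbour in A at all; if there is none, v is isolated in the complement. *)
Lemma threshold_extremal r w A t : symmetric r -> irreflexive r ->
  threshold r w -> extremal r A t.
Proof.
have [n] := ubnP #|A|; elim: n => // n IH in r w A t *.
rewrite ltnS => An sr ir th.
have [->|/set0Pn[a aA]] := eqVneq A set0.
  by apply: Or31; exists set0; split; [exact: sub0set|move=> x y; rewrite inE].
have small v : v \in A -> (#|A :\ v| < n)%N.
  by move=> vA; apply: leq_trans An; rewrite [X in (_ < X)%N](cardsD1 v) vA.
case: (@arg_maxP _ _ V a (mem A) w aA) => v /= vA vmax.
have [/existsP[y /andP[yA yv]]|dom] :=
    boolP [exists y, (y \in A) && rel_compl r v y].
  apply: (@extremal_isolated r A y) => //; last by apply: IH th => //; apply: small.
  move=> u uA; apply/negbTE/negP => ryu.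
  move/andP: yv => [yv]; apply/negP; rewrite negbK.
  apply: (th u v y); [exact: vmax|by rewrite eq_sym|by rewrite sr].
apply: extremal_compl => //.
apply: (@extremal_isolated _ A v) => //.
- exact: compl_sym.
- exact: compl_irr.
- by move=> x xA; apply: contraNF dom => h; apply/existsP; exists x; rewrite xA.
- apply: (IH _ (fun x => - w x)); [exact: small|exact: compl_sym|exact: compl_irr|].
  exact: threshold_compl.
Qed.

End Threshold.

(** * The value of Lambda *)

Lemma ord4P (P : 'I_4 -> Prop) : P (inord 0) -> P (inord 1) -> P (inord 2) ->
  P (inord 3) -> forall i, P i.
Proof.
move=> P0 P1 P2 P3 i; rewrite -(inord_val i).
by case: i => -[|[|[|[|]]]].
Qed.

Lemma is_embedding_H (V : finType) (G : sgraph V) (f : {ffun 'I_4 -> V}) :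
  is_embedding H G f =
  [&& adj G (f (inord 0)) (f (inord 2)),
      rel_compl (adj G) (f (inord 1)) (f (inord 3)),
      f (inord 0) != f (inord 1), f (inord 0) != f (inord 3),
      f (inord 2) != f (inord 1) & f (inord 2) != f (inord 3)].
Proof.
apply/idP/idP.
  case/and3P=> /injectiveP fi /forallP/(_ (inord 0))/forallP/(_ (inord 2)) r.
  move/forallP/(_ (inord 1))/forallP/(_ (inord 3)) => b.
  move: r b; rewrite adj_compl /rel_compl.
  rewrite /= !adj_graph_of_rel -!val_eqE /= !inordK //= => -> ->.
  by rewrite !(inj_eq fi) -!val_eqE /= !inordK.
case/and5P=> a02 c13 n01 n03 /andP[n21 n23].
have n02 : f (inord 0) != f (inord 2).
  by apply: contraTneq a02 => ->; rewrite adj_irr.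
have n13 : f (inord 1) != f (inord 3) by case/andP: c13.
apply/and3P; split.
- apply/injectiveP; apply: ord4P; apply: ord4P => // /eqP;
  by rewrite ?(negbTE n01) ?(negbTE n03) ?(negbTE n21) ?(negbTE n23)
     ?(negbTE n02) ?(negbTE n13) // eq_sym
     ?(negbTE n01) ?(negbTE n03) ?(negbTE n21) ?(negbTE n23)
     ?(negbTE n02) ?(negbTE n13).
- apply/forallP; apply: ord4P; apply/forallP; apply: ord4P;
  rewrite /= adj_graph_of_rel -!val_eqE /= !inordK //= ?a02 //.
  by rewrite adj_sym.
- apply/forallP; apply: ord4P; apply/forallP; apply: ord4P;
  rewrite /= adj_graph_of_rel -!val_eqE /= !inordK //= adj_compl.
  all: by rewrite ?(eq_sym (f (inord 3))) ?(adj_sym G (f (inord 3)))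
      -/(rel_compl (adj G) _ _).
Qed.

Lemma Lambda_sum (V : finType) (G : sgraph V) : (Lambda H G)%:Z =
  \sum_x \sum_z \sum_y \sum_w
    [&& adj G x z, rel_compl (adj G) y w, x != y, x != w, z != y & z != w]%:R.
Proof.
rewrite /Lambda -sum1_card big_mkcond /= -natz natr_sum.
pose F (f : {ffun 'I_4 -> V}) : int := (is_embedding H G f)%:R.
transitivity (\sum_f F f).
  by apply: eq_bigr => f _; rewrite inE /F; case: ifP.
(* In ((x, z), (y, w)) the first pair is the image of the red edge 02, the second that of the blue
   edge 13. *)
pose mk (p : (V * V) * (V * V)) : {ffun 'I_4 -> V} :=
  [ffun i : 'I_4 => nth p.1.1 [:: p.1.1; p.2.1; p.1.2; p.2.2] i].
have mk_bij : bijective mk.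
  exists (fun f : {ffun 'I_4 -> V} =>
    ((f (inord 0), f (inord 2)), (f (inord 1), f (inord 3)))).
    by move=> [[x z] [y w]]; rewrite !ffunE !inordK.
  by move=> f; apply/ffunP; apply: ord4P; rewrite ffunE inordK.
rewrite (reindex mk) /=; last exact: onW_bij.
rewrite (eq_bigr (fun p : (V * V) * (V * V) =>
  F (mk ((p.1.1, p.1.2), (p.2.1, p.2.2))))); last first.
  by move=> [[x z] [y w]].
rewrite -(pair_bigA _ (fun p q : V * V => F (mk ((p.1, p.2), (q.1, q.2))))) /=.
rewrite -(pair_bigA _ (fun x z => \sum_q F (mk ((x, z), (q.1, q.2))))) /=.
apply: eq_bigr => x _; apply: eq_bigr => z _.
rewrite -(pair_bigA _ (fun y w => F (mk ((x, z), (y, w))))) /=.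
apply: eq_bigr => y _; apply: eq_bigr => w _.
by rewrite /F is_embedding_H !ffunE !inordK.
Qed.

Definition tau (n : nat) : int := (n%:Z - 1) * (n%:Z - 4).

Lemma sum_setT (V : finType) (F : V -> int) : \sum_(x in [set: V]) F x = \sum_x F x.
Proof. by apply: eq_bigl => x; rewrite inE. Qed.

Lemma sum_eq1 (V : finType) (x : V) (F : V -> int) :
  \sum_y (y == x)%:R * F y = F x.
Proof. by rewrite -sum_setT sum_pred1 ?inE. Qed.

Lemma LambdaE (V : finType) (G : sgraph V) :
  (Lambda H G)%:Z = score (tau #|V|) (adj G) setT.
Proof.
pose r x y : int := (adj G x y)%:R; pose c x y : int := (rel_compl (adj G) x y)%:R.
pose d x := \sum_y r x y; pose d' x := \sum_y c x y.
have rs x y : r x y = r y x by rewrite /r adj_sym.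
have cs x y : c x y = c y x by rewrite /c (compl_sym (@adj_sym _ G)).
(* An edge and a non-edge share at most one vertex, so at most one of the four coincidences holds
   and inclusion-exclusion stops at first order. *)
have incl x z y w :
    [&& adj G x z, rel_compl (adj G) y w, x != y, x != w, z != y & z != w]%:R =
    r x z * c y w - (y == x)%:R * (r x z * c y w)
    - (w == x)%:R * (r x z * c y w) - (y == z)%:R * (r x z * c y w)
    - (w == z)%:R * (r x z * c y w).
  rewrite /r /c /rel_compl (eq_sym x y) (eq_sym x w) (eq_sym z y) (eq_sym z w).
  have [xz|xz] := boolP (adj G x z); last by rewrite !(mul0r, mulr0, subr0).
  have [/andP[ynw yw]|_] := boolP (_ && ~~ adj G y w); last by rewrite !(mulr0, subr0).
  have xnz : x != z by apply: contraTneq xz => ->; rewrite adj_irr.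
  have n12 : ~~ ((y == x) && (w == x)).
    by apply: contra ynw => /andP[/eqP-> /eqP->].
  have n34 : ~~ ((y == z) && (w == z)).
    by apply: contra ynw => /andP[/eqP-> /eqP->].
  have n13 : ~~ ((y == x) && (y == z)).
    by apply: contra xnz => /andP[/eqP<- /eqP<-].
  have n24 : ~~ ((w == x) && (w == z)).
    by apply: contra xnz => /andP[/eqP<- /eqP<-].
  have n14 : ~~ ((y == x) && (w == z)).
    by apply: contra yw => /andP[/eqP-> /eqP->].
  have n23 : ~~ ((w == x) && (y == z)).
    by apply: contra yw => /andP[/eqP-> /eqP->]; rewrite adj_sym.
  move: n12 n34 n13 n24 n14 n23.
  by case: (y == x); case: (w == x); case: (y == z); case: (w == z).
have dE : edge2 (adj G) setT = \sum_x d x.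
  rewrite /edge2 sum_setT; apply: eq_bigr => x _.
  by rewrite /deg sum_setT.
have PE : deg2 (adj G) setT = \sum_x d x ^+ 2.
  rewrite /deg2 sum_setT; apply: eq_bigr => x _.
  by rewrite /deg sum_setT.
have d'E x : d' x = #|V|%:Z - 1 - d x.
  have := @deg_compl V (adj G) setT (@adj_irr _ G) x (in_setT _).
  by rewrite /deg !sum_setT cardsT.
have main : \sum_x \sum_z \sum_y \sum_w r x z * c y w =
    (\sum_x d x) * (\sum_y d' y).
  rewrite mulr_suml; apply: eq_bigr => x _; rewrite mulr_suml.
  apply: eq_bigr => z _; rewrite mulr_sumr; apply: eq_bigr => y _.
  by rewrite mulr_sumr.
have e1 : \sum_x \sum_z \sum_y \sum_w (y == x)%:R * (r x z * c y w) = \sum_x d x * d' x.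
  apply: eq_bigr => x _; rewrite mulr_suml; apply: eq_bigr => z _.
  rewrite mulr_sumr exchange_big /=; apply: eq_bigr => w _.
  by rewrite (sum_eq1 x (fun y => r x z * c y w)).
have e2 : \sum_x \sum_z \sum_y \sum_w (w == x)%:R * (r x z * c y w) = \sum_x d x * d' x.
  apply: eq_bigr => x _; rewrite mulr_suml; apply: eq_bigr => z _.
  rewrite mulr_sumr; apply: eq_bigr => y _.
  by rewrite (sum_eq1 x (fun w => r x z * c y w)) cs.
have e3 : \sum_x \sum_z \sum_y \sum_w (y == z)%:R * (r x z * c y w) = \sum_x d x * d' x.
  rewrite -e1 exchange_big; apply: eq_bigr => x _; apply: eq_bigr => z _.
  by apply: eq_bigr => y _; apply: eq_bigr => w _; rewrite rs.
have e4 : \sum_x \sum_z \sum_y \sum_w (w == z)%:R * (r x z * c y w) = \sum_x d x * d' x.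
  rewrite -e2 exchange_big; apply: eq_bigr => x _; apply: eq_bigr => z _.
  by apply: eq_bigr => y _; apply: eq_bigr => w _; rewrite rs.
rewrite Lambda_sum.
under eq_bigr => x _ do under eq_bigr => z _ do under eq_bigr => y _ do
  under eq_bigr => w _ do rewrite incl.
have sB4 (F F' : V -> V -> V -> V -> int) :
    \sum_x \sum_z \sum_y \sum_w (F x z y w - F' x z y w) =
    \sum_x \sum_z \sum_y \sum_w F x z y w - \sum_x \sum_z \sum_y \sum_w F' x z y w.
  rewrite -sumrB; apply: eq_bigr => x _; rewrite -sumrB; apply: eq_bigr => z _.
  by rewrite -sumrB; apply: eq_bigr => y _; rewrite -sumrB.
rewrite !sB4 e1 e2 e3 e4 main.
have -> : \sum_y d' y = #|V|%:Z * (#|V|%:Z - 1) - \sum_x d x.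
  under eq_bigr => y _ do rewrite d'E.
  by rewrite sumrB -sum_setT sum_const cardsT.
have -> : \sum_x d x * d' x = (#|V|%:Z - 1) * (\sum_x d x) - \sum_x d x ^+ 2.
  rewrite mulr_sumr -sumrB; apply: eq_bigr => x _; rewrite d'E; ring.
by rewrite /score dE PE /tau; ring.
Qed.

(** * Moving an edge *)

Definition move_edge (V : finType) (G : sgraph V) (x u v : V) : sgraph V :=
  graph_of_rel (fun y z => (y == v) && (z == x) ||
    adj G y z && ~~ ((y == u) && (z == x) || (y == x) && (z == u))).

(** The integer form with correction terms lets the degrees follow by linearity. *)
Lemma adj_move_edge (V : finType) (G : sgraph V) (x u v y z : V) :
  x != v -> adj G u x -> ~~ adj G v x ->
  (adj (move_edge G x u v) y z)%:R =
  (adj G y z)%:R + (y == v)%:R * (z == x)%:R + (y == x)%:R * (z == v)%:R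
  - (y == u)%:R * (z == x)%:R - (y == x)%:R * (z == u)%:R :> int.
Proof.
move=> xv ux vx; rewrite adj_graph_of_rel.
have uv : u != v by apply: contraNneq vx => <-.
have xu : x != u by apply: contraTneq ux => ->; rewrite adj_irr.
have [->|yz] := eqVneq y z.
  rewrite adj_irr; have [->|_] := eqVneq z x; last by rewrite !(mulr0, mul0r).
  by rewrite (negbTE xv) (negbTE xu).
rewrite (adj_sym G z y).
have [yx|yx] := eqVneq y x.
  rewrite yx in yz *; rewrite (negbTE xv) (negbTE xu) eq_sym (negbTE yz) !andbF /=.
  have [->|zv] := eqVneq z v.
    by rewrite (adj_sym G x) (negbTE vx) eq_sym (negbTE uv) !mulr0.
  have [->|zu] := eqVneq z u; first by rewrite (adj_sym G x) ux.
  by rewrite !andbT orbb !(mulr0, mul1r, mul0r, addr0, subr0).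
have [zx|zx] := eqVneq z x.
  rewrite zx (negbTE xu) (negbTE xv) !andbF !andbT /=.
  have [->|yv] := eqVneq y v.
    by rewrite (negbTE vx) eq_sym (negbTE uv) !mul0r.
  have [->|yu] := eqVneq y u; first by rewrite ux.
  by rewrite !andbT orbb !(mulr0, mul1r, mul0r, addr0, subr0).
by rewrite !andbF !andbT orbb !(mulr0, mul1r, mul0r, addr0, subr0).
Qed.

Lemma deg_move_edge (V : finType) (G : sgraph V) (x u v y : V) :
  x != v -> adj G u x -> ~~ adj G v x ->
  deg (adj (move_edge G x u v)) setT y =
  deg (adj G) setT y + (y == v)%:R - (y == u)%:R.
Proof.
move=> xv ux vx; rewrite /deg !sum_setT.
under eq_bigr => z _ do rewrite adj_move_edge //.
have S (a : V) (c : int) : \sum_z c * (z == a)%:R = c.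
  by under eq_bigr => z _ do rewrite mulrC; rewrite sum_eq1.
by rewrite !(sumrB, big_split) /= !S; ring.
Qed.

Lemma score_move_edge (V : finType) (G : sgraph V) (x u v : V) (t : int) :
  x != v -> adj G u x -> ~~ adj G v x ->
  score t (adj (move_edge G x u v)) setT = score t (adj G) setT
    + 8 * (deg (adj G) setT v - deg (adj G) setT u + 1).
Proof.
move=> xv ux vx; set d := deg (adj G) setT.
have uv : u != v by apply: contraNneq vx => <-.
have dE y : deg (adj (move_edge G x u v)) setT y = d y + (y == v)%:R - (y == u)%:R.
  exact: deg_move_edge.
have S (a : V) : \sum_y (y == a)%:R = 1 :> int.
  by rewrite -[RHS](sum_eq1 a (fun=> 1)); apply: eq_bigr => y _; rewrite mulr1.
have e : edge2 (adj (move_edge G x u v)) setT = edge2 (adj G) setT.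
  rewrite /edge2 !sum_setT; under eq_bigr => y _ do rewrite dE.
  by rewrite sumrB big_split /= !S addrK.
have p : deg2 (adj (move_edge G x u v)) setT =
    deg2 (adj G) setT + 2 * (d v - d u + 1).
  rewrite /deg2 !sum_setT.
  have -> : \sum_y deg (adj (move_edge G x u v)) setT y ^+ 2 =
    \sum_y (d y ^+ 2 + (y == v)%:R * (2 * d y + 1) + (y == u)%:R * (1 - 2 * d y)).
    apply: eq_bigr => y _; rewrite dE.
    have [->|yv] := eqVneq y v; first by rewrite eq_sym (negbTE uv) /=; ring.
    by case: (y == u) => /=; ring.
  by rewrite !big_split /= !sum_eq1; ring.
by rewrite /score e p; ring.
Qed.

(** Otherwise moving ux to vx would gain 8 (d(v) - d(u) + 1) >= 8. *)
Lemma maximal_threshold (V : finType) (G : sgraph V) :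
  (forall G' : sgraph V, Lambda H G' <= Lambda H G)%N ->
  threshold (adj G) (deg (adj G) setT).
Proof.
move=> max u v x duv xv ux; apply/negPn/negP => vx.
have := max (move_edge G x u v); rewrite -lez_nat !LambdaE score_move_edge //.
lia.
Qed.

(** * Isomorphisms and quasi-cliques *)

Lemma iso_deg (V W : finType) (G : sgraph V) (G' : sgraph W) (f : V -> W) :
  bijective f -> (forall x y, adj G' (f x) (f y) = adj G x y) ->
  forall x, deg (adj G') setT (f x) = deg (adj G) setT x.
Proof.
move=> bf fE x; rewrite /deg !sum_setT (reindex f) /=; last exact: onW_bij.
by apply: eq_bigr => y _; rewrite fE.
Qed.

Lemma iso_edge2 (V W : finType) (G : sgraph V) (G' : sgraph W) :
  graph_iso G G' -> edge2 (adj G) setT = edge2 (adj G') setT.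
Proof.
case=> f bf fE; rewrite /edge2 !sum_setT [RHS](reindex f) /=; last exact: onW_bij.
by apply: eq_bigr => x _; rewrite (iso_deg bf fE).
Qed.

Lemma iso_score (V W : finType) (G : sgraph V) (G' : sgraph W) t :
  graph_iso G G' -> score t (adj G) setT = score t (adj G') setT.
Proof.
move=> i; rewrite /score (iso_edge2 i); congr (_ + 4 * _).
case: i => f bf fE; rewrite /deg2 !sum_setT [RHS](reindex f) /=; last exact: onW_bij.
by apply: eq_bigr => x _; rewrite (iso_deg bf fE).
Qed.

Lemma iso_Lambda (V : finType) (G G' : sgraph V) :
  graph_iso G G' -> Lambda H G = Lambda H G'.
Proof. by move=> i; apply/eqP; rewrite -eqz_nat !LambdaE (iso_score _ i). Qed.

Lemma iso_compl (V W : finType) (G : sgraph V) (G' : sgraph W) :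
  graph_iso (graph_compl G) G' -> graph_iso G (graph_compl G').
Proof.
case=> f bf fE; exists f => // x y.
rewrite adj_compl fE adj_compl (inj_eq (bij_inj bf)).
by have [->|_] := eqVneq x y; rewrite ?adj_irr ?negbK.
Qed.

(** List each set followed by its complement, and match the two lists position by position. *)
Lemma card_bij (V : finType) (A B : {set V}) : #|A| = #|B| ->
  exists2 f : V -> V, bijective f & forall x, (f x \in B) = (x \in A).
Proof.
move=> AB; pose l (C : {set V}) := enum C ++ enum (~: C).
have lu C : uniq (l C).
  rewrite cat_uniq !enum_uniq andbT /=; apply/hasPn => x.
  by rewrite !mem_enum !inE.
have lin C x : x \in l C by rewrite mem_cat !mem_enum !inE orbN.
have ls C D : size (l C) = size (l D).
  by rewrite !size_cat -!cardE !cardsC.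
pose f x := nth x (l B) (index x (l A)).
have lt x : (index x (l A) < size (l B))%N by rewrite (ls B A) index_mem.
have fi : injective f.
  move=> x y; rewrite /f (set_nth_default y x) // => /eqP.
  by rewrite nth_uniq // => /eqP E; rewrite -(nth_index y (lin A x)) E nth_index.
exists f; first exact: injF_bij.
move=> x; rewrite /f nth_cat -cardE -AB.
have -> : (index x (l A) < #|A|)%N = (x \in A).
  rewrite index_cat mem_enum; case: ifP => [xA|_]; last by rewrite -cardE ltnNge leq_addr.
  by rewrite cardE index_mem mem_enum.
case: ifP => xA.
  rewrite -mem_enum mem_nth // -cardE -AB index_cat mem_enum xA.
  by rewrite cardE index_mem mem_enum.
have : nth x (enum (~: B)) (index x (l A) - #|A|) \in enum (~: B).
  rewrite mem_nth // index_cat mem_enum xA -cardE addKn -cardE.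
  have -> : #|~: B| = #|~: A|.
    by apply/eqP; rewrite -(eqn_add2l #|B|) cardsC -{1}AB cardsC.
  by rewrite [X in (_ < X)%N]cardE index_mem mem_enum inE xA.
by rewrite mem_enum inE => /negbTE.
Qed.

Lemma clique_iso (V : finType) (G G' : sgraph V) (B B' : {set V}) :
  clique_on (adj G) setT B -> clique_on (adj G') setT B' -> #|B| = #|B'| ->
  graph_iso G G'.
Proof.
move=> [_ c] [_ c'] /card_bij[f bf fB]; exists f => // x y.
by rewrite c ?c' ?inE // !fB (inj_eq (bij_inj bf)).
Qed.

Lemma eq_clique_on (V : finType) (r r' : rel V) (A B : {set V}) :
  r =2 r' -> clique_on r A B -> clique_on r' A B.
Proof. by move=> rr [? c]; split=> // x y xA yA; rewrite -rr c. Qed.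

Lemma card_ltn (n k : nat) : (k <= n)%N -> #|[set i : 'I_n | (i < k)%N]| = k.
Proof.
move=> kn; rewrite -sum1_card.
rewrite (eq_bigl (fun i : 'I_n => (i < k)%N)); last by move=> i; rewrite inE.
by rewrite -(big_ord_widen n (fun=> 1%N) kn) sum1_card card_ord.
Qed.

Lemma qc_k_bin (k : nat) : (0 < k)%N -> qc_k 'C(k.+1, 2) = k.
Proof.
move=> k0; have [|lt max] := @qc_kP 'C(k.+1, 2); first by rewrite bin_gt0.
apply/eqP; rewrite eqn_leq (max k) ?andbT; last first.
  by rewrite binS bin1 -[X in (X < _)%N]addn0 ltn_add2l.
rewrite leqNgt; apply/negP => kq; move: lt; rewrite ltnNge => /negP; apply.
exact: leq_bin2l.
Qed.

(** For this number of edges [qc_k] is k and the deleted star is empty. *)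
Lemma QC_clique (n k : nat) : (0 < k)%N ->
  clique_on (adj (QC n 'C(k.+1, 2))) setT [set i : 'I_n | (i < k.+1)%N].
Proof.
move=> k0; split=> [|x y _ _]; first exact: subsetT.
rewrite adj_graph_of_rel qc_k_bin // subnn !ltn0 !andbF !andbT !inE !ltnS.
rewrite -val_eqE /=; lia.
Qed.

(** * Maximal cliques *)

Definition disc (n : nat) : int := 2 * n%:Z ^+ 2 - 10 * n%:Z + 13.

(** With s the square root of D, the floor says 2 k0 - 3 <= s < 2 k0 - 1; squaring removes the
    reals. *)
Lemma k0_bounds (R : realType) (n : nat) : (4 <= n)%N ->
  [/\ (1 < k0 R n)%N, (2 * (k0 R n)%:Z - 3) ^+ 2 <= disc n
    & disc n < (2 * (k0 R n)%:Z - 1) ^+ 2].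
Proof.
move=> hn; have D1 : 1 <= disc n by rewrite /disc; nia.
have DR : 2 * n%:R ^+ 2 - 10 * n%:R + 13 = (disc n)%:~R :> R.
  by rewrite /disc; ring.
pose s : R := Num.sqrt (disc n)%:~R.
have s0 : 0 <= s by apply: sqrtr_ge0.
have s2 : s ^+ 2 = (disc n)%:~R by rewrite sqr_sqrtr // ler0z; lia.
have s1 : 1 <= s.
  by rewrite -(@ler_pXn2r _ 2) ?nnegrE // s2 expr1n ler1z.
have xE : x0 R n = (3 + s) / 2 by rewrite /x0 DR.
have f2 : 2 <= Num.floor (x0 R n) by rewrite floor_ge_int xE; lra.
have kE : (k0 R n)%:Z = Num.floor (x0 R n) by rewrite /k0 gez0_abs //; lia.
have := floor_itv (x0 R n); rewrite -kE xE => /andP[lo hi].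
rewrite -kE in f2; split.
- by rewrite -ltz_nat; lia.
- rewrite -(ler_int R) -s2 rmorphXn /= ler_pXn2r ?nnegrE //.
    by rewrite rmorphB rmorphM /=; lra.
  by rewrite ler0z; lia.
- rewrite -(ltr_int R) -s2 rmorphXn /= ltr_pXn2r ?nnegrE //.
    by move: hi; rewrite rmorphB rmorphM rmorphD /=; lra.
  by rewrite ler0z; lia.
Qed.

Lemma k0_lt (R : realType) (n : nat) : (4 <= n)%N -> ((k0 R n).+1 < n)%N.
Proof.
move=> hn; have [k1 lo _] := k0_bounds R hn.
(* Otherwise (2n - 5)^2 <= D, whereas (2n - 5)^2 - D = 2 (n - 2) (n - 3) > 0. *)
rewrite ltnNge; apply/negP => nk; move: lo; rewrite /disc; nia.
Qed.

Lemma clique_val_step n k : clique_val (tau n) (k + 1) =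
  clique_val (tau n) k + k * (disc n - (2 * k - 3) ^+ 2).
Proof. by rewrite /clique_val /tau /disc; ring. Qed.

(** For 1 <= j <= k the step from j is nonnegative, as (2j - 3)^2 <= (2k - 3)^2; the step from 0 has
    the factor 0. *)
Lemma clique_val_incr n (k : int) : 2 <= k -> (2 * k - 3) ^+ 2 <= disc n ->
  forall j : nat, j%:Z <= k + 1 -> clique_val (tau n) j <= clique_val (tau n) (k + 1).
Proof.
move=> k2 lo j jk; have [d dE] : exists d : nat, d%:Z = k + 1 - j%:Z.
  by exists (absz (k + 1 - j%:Z)%R); lia.
elim: d => [|d IH] in j jk dE *; first by have -> : j%:Z = k + 1 by lia.
apply: le_trans (IH j.+1 _ _); [|lia|lia].
have -> : j.+1%:Z = j%:Z + 1 by lia.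
rewrite clique_val_step lerDl; case: (posnP j) => [->|j1]; first by rewrite mul0r.
apply: mulr_ge0 => //; rewrite subr_ge0; apply: le_trans lo; nia.
Qed.

Lemma clique_val_decr n (k : int) : 2 <= k -> disc n < (2 * k - 1) ^+ 2 ->
  forall j : nat, k + 1 < j%:Z -> clique_val (tau n) j < clique_val (tau n) (k + 1).
Proof.
move=> k2 hi; elim=> [|j IH] jk; first by lia.
have step : clique_val (tau n) j.+1 < clique_val (tau n) j.
  have -> : j.+1%:Z = j%:Z + 1 by lia.
  rewrite clique_val_step -subr_gt0 opprD addNKr -mulrN opprB; apply: mulr_gt0; first by lia.
  by rewrite subr_gt0; apply: lt_le_trans hi _; nia.
have [->|jk'] : k + 1 = j \/ k + 1 < j by lia.
  by [].
by apply: lt_trans step (IH jk').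
Qed.

Lemma clique_val_max (R : realType) (n j : nat) : (4 <= n)%N ->
  clique_val (tau n) j <= clique_val (tau n) (k0 R n).+1.
Proof.
move=> hn; have [k1 lo hi] := k0_bounds R hn.
have -> : (k0 R n).+1%:Z = (k0 R n)%:Z + 1 by lia.
have [jk|jk] := leP j%:Z ((k0 R n)%:Z + 1).
  by apply: clique_val_incr => //; lia.
by apply/ltW/clique_val_decr => //; lia.
Qed.

Lemma clique_val_max_uniq (R : realType) (n j : nat) : (4 <= n)%N -> ~ disc_square n ->
  clique_val (tau n) j = clique_val (tau n) (k0 R n).+1 -> j = (k0 R n).+1.
Proof.
move=> hn nsq; have [k1 lo hi] := k0_bounds R hn.
have -> : (k0 R n).+1%:Z = (k0 R n)%:Z + 1 by lia.
have lo' : (2 * (k0 R n)%:Z - 3) ^+ 2 < disc n.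
  by rewrite lt_neqAle lo andbT; apply/eqP => E; apply: nsq;
    exists (2 * (k0 R n)%:Z - 3); exact: esym E.
have step : clique_val (tau n) (k0 R n) < clique_val (tau n) ((k0 R n)%:Z + 1).
  by rewrite clique_val_step ltrDl; apply: mulr_gt0; [lia|rewrite subr_gt0].
have [jk E|jk E] := leP j%:Z ((k0 R n)%:Z + 1); last first.
  by have := @clique_val_decr n (k0 R n) _ hi j jk; rewrite E ltxx => /(_ _)/negP; lia.
apply/eqP; rewrite -eqz_nat; apply/eqP/le_anti/andP; split; first by lia.
rewrite leNgt; apply/negP => jk'.
have jk2 : j%:Z <= (k0 R n)%:Z - 1 + 1 by lia.
(* The step into k0 + 1 is strict; below it [clique_val_incr] is applied with k0 - 1, which must be
   at least 2. The case k0 = 2 is computed by hand. *)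
have [k2|k2] := leqP 3 (k0 R n).
  have := @clique_val_incr n ((k0 R n)%:Z - 1) _ _ j jk2; rewrite subrK E.
  have h1 : 2 <= (k0 R n)%:Z - 1 by lia.
  have h2 : (2 * ((k0 R n)%:Z - 1) - 3) ^+ 2 <= disc n by apply: le_trans lo; nia.
  by move=> /(_ h1 h2); rewrite leNgt step.
have k_eq : k0 R n = 2%N by lia.
move: E step lo'; rewrite k_eq => E step lo'.
have [j2|j2] : j = 2%N \/ (j <= 1)%N by lia.
  by move: step; rewrite -E j2 ltxx.
have j0 : clique_val (tau n) j = 0.
  by case: j j2 {jk jk' jk2 E} => [|[|//]] _; rewrite ?clique_val0 ?clique_val1.
have := clique_val_step n 1; have := clique_val_step n 2; rewrite clique_val1 -E j0.
by rewrite -[1 + 1]/2 => -> /eqP; nia.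
Qed.

(** * The parameter [tau n], fixed by complementation *)

Lemma dual_tau (n : nat) : dual_param n (tau n) = tau n.
Proof. by rewrite /dual_param /tau; ring. Qed.

Lemma shift_tau (n : nat) : dual_shift n (tau n) = 0.
Proof. by rewrite /dual_shift /tau; ring. Qed.

Lemma coclique_val_tau (n k : nat) : coclique_val n (tau n) k = clique_val (tau n) k.
Proof. by rewrite /coclique_val dual_tau shift_tau subr0. Qed.

Lemma Lambda_compl (n : nat) (G : sgraph 'I_n) :
  Lambda H (graph_compl G) = Lambda H G.
Proof.
apply/eqP; rewrite -eqz_nat !LambdaE.
rewrite (@eq_score _ _ (rel_compl (adj G))) => [|x y _ _]; last exact: adj_compl.
have := score_compl setT (tau n) (@adj_irr _ G).
by rewrite cardsT card_ord dual_tau shift_tau addr0 => ->.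
Qed.

Lemma Lambda_clique (n : nat) (G : sgraph 'I_n) (B : {set 'I_n}) :
  clique_on (adj G) setT B -> (Lambda H G)%:Z = clique_val (tau n) #|B|.
Proof. by move=> c; rewrite LambdaE card_ord (score_clique _ c). Qed.

Lemma maximal_extremal (n : nat) (G : sgraph 'I_n) :
  Lambda H G = Lambda_max H n ->
  [\/ exists B, clique_on (adj G) setT B,
      exists B, clique_on (adj (graph_compl G)) setT B
    | exists2 k : nat, (0 < k)%N & (Lambda H G)%:Z < clique_val (tau n) k \/
        clique_val (tau n) k = Lambda H G /\ clique_val (tau n) k.+1 = Lambda H G].
Proof.
move=> Gmax; have th : threshold (adj G) (deg (adj G) setT).
  by apply: maximal_threshold => G'; rewrite Gmax; exact: leq_bigmax.
have := @threshold_extremal _ _ _ setT (tau n) (@adj_sym _ G) (@adj_irr _ G) th.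
have := LambdaE G; rewrite /extremal cardsT card_ord => <-.
case=> [c|[B c]|h]; first exact: Or31.
  by apply: Or32; exists B; apply: eq_clique_on c => x y; rewrite adj_compl.
apply: Or33; case: h => -[k km]; rewrite !coclique_val_tau => h.
  (* Order 0 is traded for order 1, which has the same value 0. *)
  case: k => [|k] in h {km} *.
    by exists 1%N => //; left; rewrite clique_val1 -(clique_val0 (tau n)); case: h.
  by exists k.+1 => //; left; case: h.
by case/andP: km => k1 _; exists k => //; right; case: h.
Qed.

(** * Graphs between two consecutive cliques *)

Definition partial_clique (n k j : nat) : sgraph 'I_n :=
  graph_of_rel (fun x y : 'I_n =>
    ((x < k) && ((y < k) || (y == k :> nat) && (x < j)))%N).

Section PartialClique.
Variables (n k j : nat).
Hypotheses (kn : (k < n)%N) (jk : (j <= k)%N).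

Lemma sum_ltn m : (m <= n)%N -> \sum_(y < n) (y < m)%N%:R = m%:Z.
Proof.
move=> mn; rewrite -[in RHS](card_ltn mn) -(@sum_mem _ setT) ?subsetT //.
by rewrite sum_setT; apply: eq_bigr => y _; rewrite inE.
Qed.

Lemma sum_eqn : \sum_(y < n) (y == k :> nat)%:R = 1 :> int.
Proof.
by rewrite -[RHS](sum_eq1 (Ordinal kn) (fun=> 1)); apply: eq_bigr => y _; rewrite mulr1.
Qed.

Lemma deg_partial_clique (x : 'I_n) :
  deg (adj (partial_clique n k j)) setT x =
  (x < k)%N%:R * (k%:Z - 1) + (x == k :> nat)%:R * j%:Z + (x < j)%N%:R.
Proof.
rewrite /deg sum_setT.
have -> : \sum_y (adj (partial_clique n k j) x y)%:R =
   \sum_(y < n) ((x < k)%N%:R * ((y < k)%N%:R - (y == x)%:R * 1)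
     + (x == k :> nat)%:R * (y < j)%N%:R + (x < j)%N%:R * (y == k :> nat)%:R) :> int.
  apply: eq_bigr => y _; rewrite adj_graph_of_rel -!val_eqE /= (eq_sym (x : nat)).
  case: (ltngtP x k) => xk; case: (ltngtP y k) => yk;
  case: (ltnP x j) => xj; case: (ltnP y j) => yj; case: eqP => yx //=; lia.
rewrite !big_split /= -!mulr_sumr sumrB sum_ltn ?(ltnW kn) // sum_ltn; last by lia.
by rewrite sum_eqn (sum_eq1 x (fun=> 1)) mulr1.
Qed.

Lemma edge2_partial_clique :
  edge2 (adj (partial_clique n k j)) setT = k%:Z * (k%:Z - 1) + 2 * j%:Z.
Proof.
rewrite /edge2 sum_setT; under eq_bigr => x _ do rewrite deg_partial_clique.
rewrite !big_split /= -!mulr_suml sum_eqn !sum_ltn; [ring|lia|lia].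
Qed.

Lemma deg2_partial_clique : deg2 (adj (partial_clique n k j)) setT =
  k%:Z * (k%:Z - 1) ^+ 2 + j%:Z ^+ 2 + j%:Z * (2 * k%:Z - 1).
Proof.
rewrite /deg2 sum_setT.
have -> : \sum_x deg (adj (partial_clique n k j)) setT x ^+ 2 =
    \sum_(x < n) ((x < k)%N%:R * (k%:Z - 1) ^+ 2
      + (x == k :> nat)%:R * j%:Z ^+ 2 + (x < j)%N%:R * (2 * k%:Z - 1)).
  apply: eq_bigr => x _; rewrite deg_partial_clique.
  case: (ltngtP x k) => xk; case: (ltnP x j) => xj /=; try lia; ring.
rewrite !big_split /= -!mulr_suml sum_eqn !sum_ltn; [ring|lia|lia].
Qed.

(** The terms in j^2 from - E^2 and from 4 sum d^2 cancel, so the value is linear in j, and constant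
    when D = (2k - 3)^2. *)
Lemma Lambda_partial_clique : (Lambda H (partial_clique n k j))%:Z =
  clique_val (tau n) k + j%:Z * (disc n - (2 * k%:Z - 3) ^+ 2).
Proof.
rewrite LambdaE card_ord /score edge2_partial_clique deg2_partial_clique.
by rewrite /clique_val /tau /disc; ring.
Qed.

Lemma partial_clique_isolated (kn1 : (k.+1 < n)%N) (y : 'I_n) :
  adj (partial_clique n k j) (Ordinal kn1) y = false.
Proof. by rewrite adj_graph_of_rel -val_eqE /=; lia. Qed.

End PartialClique.

(** In the complement of G' the vertex b is adjacent to all others. Its preimage is so in G and must
    therefore be the isolated a, which is not adjacent to c. *)
Lemma isolated_not_iso_compl (V : finType) (G G' : sgraph V) (a b c : V) :
  a != c -> (forall x, adj G a x = false) -> (forall x, adj G' b x = false) ->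
  ~ graph_iso G (graph_compl G').
Proof.
move=> ac ia ib [f bf fE]; have [g _ gK] := bf.
have adjb x : adj G (g b) x = (g b != x).
  by rewrite -fE gK adj_compl ib andbT -{1}(gK b) (inj_eq (bij_inj bf)).
have ga : g b = a.
  by apply/eqP; apply: negbFE; rewrite -adjb adj_sym ia.
by have := adjb c; rewrite ga ia ac.
Qed.

Lemma edge2_complK (V : finType) (G : sgraph V) :
  edge2 (adj (graph_compl (graph_compl G))) setT = edge2 (adj G) setT.
Proof.
apply: eq_bigr => x _; apply: eq_bigr => y _; congr (nat_of_bool _)%:R.
rewrite !adj_compl negb_and !negbK.
by have [->|] := eqVneq x y; rewrite ?adj_irr.
Qed.

Lemma tied_family (n k : nat) (v : int) : (k.+1 < n)%N ->
  (forall j, (j <= k)%N -> (Lambda H (partial_clique n k j))%:Z = v) ->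
  exists F : 'I_(2 * k.+1) -> sgraph 'I_n,
    (forall i, (Lambda H (F i))%:Z = v) /\
    (forall i j, i != j -> ~ graph_iso (F i) (F j)).
Proof.
move=> kn Pv; pose P j := partial_clique n k j.
(* Partial cliques are told apart by their numbers of edges, and from the complements by their
   isolated vertex. *)
exists (fun i => if (i <= k)%N then P i else graph_compl (P (i - k.+1)%N)); split.
  move=> i; case: leqP => ik; first exact: Pv.
  by rewrite Lambda_compl Pv //; have := ltn_ord i; lia.
have Pinj i j : (i <= k)%N -> (j <= k)%N ->
    edge2 (adj (P i)) setT = edge2 (adj (P j)) setT -> i = j.
  by move=> ik jk; rewrite !edge2_partial_clique //; [lia|exact: ltnW|exact: ltnW].
have n0 : (0 < n)%N by apply: leq_trans kn.
have PcP i j : (i <= k)%N -> (j <= k)%N -> ~ graph_iso (P i) (graph_compl (P j)).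
  move=> ik jk; apply: (@isolated_not_iso_compl _ _ _
    (Ordinal kn) (Ordinal kn) (Ordinal n0)).
  - by rewrite -val_eqE.
  - by move=> x; apply: partial_clique_isolated => //; lia.
  - by move=> x; apply: partial_clique_isolated => //; lia.
move=> i j; rewrite -val_eqE /= => ij; have := ltn_ord i; have := ltn_ord j.
case: (leqP i k) => ik; case: (leqP j k) => jk jN iN.
- by move/iso_edge2/(Pinj _ _ ik jk) => E; rewrite E eqxx in ij.
- by apply: PcP => //; lia.
- by move/iso_compl; apply: PcP => //; lia.
- by move/iso_compl/iso_edge2; rewrite edge2_complK => /Pinj E; move: ij; lia.
Qed.

(** * The maximum, its uniqueness, and the tied case *)

Section Optimum.
Variables (R : realType) (n : nat).
Hypothesis hn : (4 <= n)%N.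
Let k := k0 R n.
Let Q := QC n 'C(k.+1, 2).

Lemma QC_k0_clique : clique_on (adj Q) setT [set i : 'I_n | (i < k.+1)%N].
Proof. by apply: QC_clique; have [/ltnW] := k0_bounds R hn. Qed.

Lemma card_QC_k0_clique : #|[set i : 'I_n | (i < k.+1)%N]| = k.+1.
Proof. by rewrite card_ltn // ltnW // k0_lt. Qed.

Lemma Lambda_QC_k0 : (Lambda H Q)%:Z = clique_val (tau n) k.+1.
Proof. by rewrite (Lambda_clique QC_k0_clique) card_QC_k0_clique. Qed.

Lemma Lambda_max_QC : Lambda_max H n = Lambda H Q.
Proof.
apply/eqP; rewrite eqn_leq [X in _ && X]leq_bigmax andbT.
have [|G GE] := @bigop.eq_bigmax (sgraph 'I_n) (fun G => Lambda H G).
  by apply/card_gt0P; exists Q.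
rewrite -/(Lambda_max H n) in GE; rewrite -lez_nat Lambda_QC_k0.
case: (maximal_extremal (esym GE)) => [[B c]|[B c]|[j _ [h|[h _]]]]; rewrite GE.
- by rewrite (Lambda_clique c) clique_val_max.
- by rewrite -Lambda_compl (Lambda_clique c) clique_val_max.
- exact: le_trans (ltW h) (clique_val_max R j hn).
- by rewrite -h clique_val_max.
Qed.

Lemma Lambda_max_uniq (G : sgraph 'I_n) : ~ disc_square n ->
  Lambda H G = Lambda_max H n <-> graph_iso G Q \/ graph_iso G (graph_compl Q).
Proof.
move=> nsq; rewrite Lambda_max_QC; split=> [Gmax|[i|i]]; last first.
- by rewrite (iso_Lambda i) Lambda_compl.
- by rewrite (iso_Lambda i).
have GE : (Lambda H G)%:Z = clique_val (tau n) k.+1 by rewrite Gmax Lambda_QC_k0.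
have uniq_j (j : nat) : clique_val (tau n) j = Lambda H G -> j = k.+1.
  by rewrite GE; apply: clique_val_max_uniq.
rewrite -Lambda_max_QC in Gmax.
case: (maximal_extremal Gmax) => [[B c]|[B c]|[j _ [h|[h h']]]].
- left; apply: (clique_iso c QC_k0_clique); rewrite card_QC_k0_clique.
  by apply: uniq_j; rewrite -(Lambda_clique c).
- right; apply: iso_compl; apply: (clique_iso c QC_k0_clique).
  rewrite card_QC_k0_clique; apply: uniq_j.
  by rewrite -(Lambda_clique c) Lambda_compl.
- by move: h; rewrite GE ltNge clique_val_max.
(* A tie would make both j and j + 1 equal to k0 + 1. *)
- by move: (uniq_j _ h'); rewrite (uniq_j _ h); lia.
Qed.

Lemma Lambda_max_tied : disc_square n ->
  exists F : 'I_(2 * k.+1) -> sgraph 'I_n,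
    (forall i, Lambda H (F i) = Lambda_max H n) /\
    (forall i j, i != j -> ~ graph_iso (F i) (F j)).
Proof.
case=> m mE; have kn : (k.+1 < n)%N := k0_lt R hn.
have [k1 lo hi] := k0_bounds R hn; rewrite -/k in k1 lo hi.
have mD : disc n = `|m| ^+ 2 by rewrite real_normK ?num_real.
have sq : disc n = (2 * k%:Z - 3) ^+ 2.
  have m0 : 0 <= `|m| by apply: normr_ge0.
  move: lo hi; rewrite mD ler_pXn2r ?ltr_pXn2r ?nnegrE //; try lia.
  (* The bounds leave one other candidate, 2k - 2, excluded because D is odd. *)
  move=> lo hi; have [->//|mk] : `|m| = 2 * k%:Z - 3 \/ `|m| = 2 * k%:Z - 2 by lia.
  by move: mD; rewrite /disc mk !expr2; lia.
have [j jk|F [F1 F2]] := @tied_family n k (clique_val (tau n) k.+1) kn.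
  rewrite Lambda_partial_clique //; last exact: ltnW.
  by rewrite sq subrr mulr0 addr0 -[k.+1]addn1 PoszD clique_val_step sq subrr mulr0 addr0.
exists F; split=> // i; apply/eqP; rewrite -eqz_nat F1 Lambda_max_QC.
by rewrite Lambda_QC_k0.
Qed.

End Optimum.

Local Close Scope ring_scope.

Theorem theorem3p3 (R : realType) (n : nat) (hn : 4 <= n) :
  let k := k0 R n in
  let Q := QC n 'C(k.+1, 2) in
  Lambda_max H n = Lambda H Q /\
  (~ disc_square n ->
     forall G : sgraph 'I_n,
       Lambda H G = Lambda_max H n <->
       graph_iso G Q \/ graph_iso G (graph_compl Q)) /\
  (disc_square n ->
     exists F : 'I_(2 * k.+1) -> sgraph 'I_n,
       (forall i, Lambda H (F i) = Lambda_max H n) /\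
       (forall i j, i != j -> ~ graph_iso (F i) (F j))).
Proof.
split; first exact: Lambda_max_QC.
split=> [nsq G|]; first exact: Lambda_max_uniq.
exact: Lambda_max_tied.
Qed.
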